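(* Let $(X,Y)\in\{(\Gamma,\Gamma),(\Delta,\Gamma),(\Delta,\Delta)\}$, and let the vertex weights $\mathcal W_X,\mathcal W_Y$ and $R$-vertex weights $R_{XY}$ be as defined in the context, with spectral parameters $x,y$. Then for any colors $a,b,d,e\in\{0\}\cup[\pm n]$ and any vectors $\bm c,\bm f\in\mathbb N^{2n}$, $$\sum_{g,i,\bm h}R_{XY}(a,b,g,i;x,y)\,\mathcal W_X(i,\bm f,\bm h,e;x)\,\mathcal W_Y(g,\bm h,\bm c,d;y)=\sum_{j,l,\bm k}\mathcal W_Y(a,\bm f,\bm k,l;y)\,\mathcal W_X(b,\bm k,\bm c,j;x)\,R_{XY}(l,j,d,e;x,y),$$ where $g,i,j,l$ range over $\{0\}\cup[\pm n]$ and $\bm h,\bm k$ range over $\mathbb N^{2n}$.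
   Context: **Colors.** Fix an integer $n\ge1$. The signed colors are $[\pm n]=\{1,\dots,n,\overline n,\dots,\overline 1\}$, with $[n]=\{1,\dots,n\}$, $[\overline n]=\{\overline1,\dots,\overline n\}$; there is also a color $0$ (also written $+$). Ordering: $1<\cdots<n<0<\overline n<\cdots<\overline1$. **Vectors.** $\mathbb N=\{0,1,2,\dots\}$. Vectors $\bm I=(I_1,\dots,I_n,I_{\overline n},\dots,I_{\overline1})\in\mathbb N^{2n}$ are indexed by $[\pm n]$, with standard basis $\bm e_k$ ($k\in[\pm n]$), and $\bm e_0=0$. Put $\bm I_{[j,j']}=\sum_{k\in[\pm n],\,j\le k\le j'}I_k$, and similarly $\bm I_{<j},\bm I_{>j},\bm I_{\le j},\bm I_{\ge j}$ (sums over $k\in[\pm n]$); $\bm I_\ell=I_\ell$. **Parameters.** $q\in\mathbb C$, $s\in\mathbb C^*$, spectral parameters $x,y\in\mathbb C$, such that all denominators that occur are nonzero (in particular $q\ne0$). **$\Gamma$ weights.** $\mathcal L_x(\bm I,j,\bm K,\ell)$ is for a vertex with bottom edge $\bm I$, left edge $j$, top edge $\bm K$, right edge $\ell$ ($j,\ell\in\{0\}\cup[\pm n]$, $\bm I,\bm K\in\mathbb N^{2n}$). It is $0$ unless $\bm I+\bm e_j=\bm K+\bm e_\ell$, in which case it equals: - $\ell=0$: $\frac{q^{-\bm I_{[1,n]}}-sxq^{\bm I_{[\overline n,\overline1]}}}{1-sx}$ if $j=\ell$; $\frac{xq^{-\bm I_{[1,n]}}-s^2xq^{\bm I_{[\overline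 n,\overline1]}}}{s(1-sx)}$ if $j<\ell$; $\frac{q^{-\bm I_{[1,n]}}-s^2q^{\bm I_{[\overline n,\overline1]}}}{1-sx}$ if $j>\ell$. - $\ell\in[n]$: $\frac{(sq^{\bm I_\ell}-x)q^{-\bm I_{\le\ell}}}{s(1-sx)}$ if $j=\ell$; $\frac{-x(1-q^{\bm I_\ell})q^{-\bm I_{\le\ell}}}{s(1-sx)}$ if $j<\ell$; $\frac{-(1-q^{\bm I_\ell})q^{-\bm I_{\le\ell}}}{1-sx}$ if $j>\ell$. - $\ell\in[\overline n]$: $\frac{s(sq^{\bm I_\ell}-x)q^{\bm I_{>\ell}}}{1-sx}$ if $j=\ell$; $\frac{-sx(1-q^{\bm I_\ell})q^{\bm I_{>\ell}}}{1-sx}$ if $j<\ell$; $\frac{-s^2(1-q^{\bm I_\ell})q^{\bm I_{>\ell}}}{1-sx}$ if $j>\ell$. **$\Delta$ weights.** $\mathcal M_x(\bm I,j,\bm K,\ell)$ is for a vertex with bottom edge $\bm I$, right edge $j$, top edge $\bm K$, left edge $\ell$. It is $0$ unless $\bm I+\bm e_j=\bm K+\bm e_\ell$, in which case it equals: - $\ell=0$: $\frac{q^{-\bm I_{[\overline n,\overline1]}}-sxq^{\bm I_{[1,n]}}}{1-sx}$ if $j=\ell$; $\frac{q^{-\bm I_{[\overline n,\overline1]}}-s^2q^{\bm I_{[1,n]}}}{1-sx}$ if $j<\ell$; $\frac{x(s^{-1}q^{-\bm I_{[\overline n,\overline1]}}-sq^{\bm I_{[1,n]}})}{1-sx}$ if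 $j>\ell$. - $\ell\in[n]$: $\frac{s(sq^{\bm I_\ell}-x)q^{\bm I_{<\ell}}}{1-sx}$ if $j=\ell$; $\frac{-s^2(1-q^{\bm I_\ell})q^{\bm I_{<\ell}}}{1-sx}$ if $j<\ell$; $\frac{-sx(1-q^{\bm I_\ell})q^{\bm I_{<\ell}}}{1-sx}$ if $j>\ell$. - $\ell\in[\overline n]$: $\frac{(1-s^{-1}xq^{-\bm I_\ell})q^{-\bm I_{>\ell}}}{1-sx}$ if $j=\ell$; $\frac{-(1-q^{\bm I_\ell})q^{-\bm I_{\ge\ell}}}{1-sx}$ if $j<\ell$; $\frac{-s^{-1}x(1-q^{\bm I_\ell})q^{-\bm I_{\ge\ell}}}{1-sx}$ if $j>\ell$. **Uniform notation.** For left edge $p$, bottom edge $\bm I$, top edge $\bm K$, right edge $r$: $\mathcal W_\Gamma(p,\bm I,\bm K,r;z)=\mathcal L_z(\bm I,p,\bm K,r)$ and $\mathcal W_\Delta(p,\bm I,\bm K,r;z)=\mathcal M_z(\bm I,r,\bm K,p)$. **$R$ weights.** $R_{XY}(\alpha,\beta,\gamma,\delta;x,y)$ is the weight of an $X$-$Y$ vertex with bottom-left edge $\alpha$, top-left edge $\beta$, top-right edge $\gamma$, bottom-right edge $\delta$ in $\{0\}\cup[\pm n]$. The only nonzero values are the following, where $i,j\in\{0\}\cup[\pm n]$, $i<j$ (and $(i,i,i,i)$ is for any $i$): - $R_{\Gamma\Gamma}$: $(i,i,i,i)\mapsto1$; $(i,j,i,j)\mapsto\frac{x-y}{x-qy}$;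 $(j,i,j,i)\mapsto\frac{q(x-y)}{x-qy}$; $(j,i,i,j)\mapsto\frac{(1-q)x}{x-qy}$; $(i,j,j,i)\mapsto\frac{(1-q)y}{x-qy}$. - $R_{\Delta\Gamma}$: $(i,i,i,i)\mapsto1$; $(i,j,i,j)\mapsto\frac{qxy-1}{xy-1}$; $(j,i,j,i)\mapsto\frac{qxy-1}{q(xy-1)}$; $(j,j,i,i)\mapsto\frac{1-q}{q(xy-1)}$; $(i,i,j,j)\mapsto\frac{(1-q)xy}{xy-1}$. - $R_{\Delta\Delta}$: $(i,i,i,i)\mapsto1$; $(i,j,i,j)\mapsto\frac{y-x}{y-qx}$; $(j,i,j,i)\mapsto\frac{q(y-x)}{y-qx}$; $(j,i,i,j)\mapsto\frac{(1-q)x}{y-qx}$; $(i,j,j,i)\mapsto\frac{(1-q)y}{y-qx}$. In each of the two sums of the Yang-Baxter equation only finitely many terms are nonzero. *)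

(* Defs.v *)
From HB Require Import structures.
From mathcomp Require Import all_boot all_order all_algebra.
From mathcomp Require Import all_classical all_reals.
From mathcomp Require Import zify.
From mathcomp Require Export complex.

Set Implicit Arguments.
Unset Strict Implicit.
Unset Printing Implicit Defensive.

Import Order.TTheory GRing.Theory Num.Theory.
Local Open Scope ring_scope.

(* [inl i] is the color i+1 and [inr i] is the barred color of i+1,
   for i : 'I_n; [None] is the color 0. *)
Notation scolor n := ('I_n + 'I_n)%type.
Notation color n := (option (scolor n)).

(* Position in the chain 1 < ... < n < 0 < \bar n < ... < \bar 1. *)
Definition crank (n : nat) (a : color n) : nat :=
  match a with
  | Some (inl i) => i
  | None => n
  | Some (inr i) => n.*2 - i
  end.

Definition clt (n : nat) (a b : color n) : bool := (crank a < crank b)%N.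
Definition cle (n : nat) (a b : color n) : bool := (crank a <= crank b)%N.

Lemma crank_inj n : injective (@crank n).
Proof.
case=> [[i|i]|] [[j|j]|] //= e; try (have := ltn_ord i); try (have := ltn_ord j);
  rewrite /= in e *; try lia.
- by move=> _ _; rewrite (val_inj e).
- by move=> hj hi; congr (Some (inr _)); apply: val_inj => /=; lia.
Qed.

Notation cvec n := {ffun scolor n -> nat}.

(* [evec None] is the zero vector. *)
Definition evec (n : nat) (a : color n) : cvec n := [ffun k => (a == Some k) : nat].

Section PartialSums.
Local Open Scope nat_scope.
Variables (n : nat) (I : cvec n).

Definition sum_unbarred : nat := \sum_(i < n) I (inl i).
Definition sum_barred : nat := \sum_(i < n) I (inr i).
Definition sum_lt (l : scolor n) : nat := \sum_(k | clt (Some k) (Some l)) I k.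
Definition sum_le (l : scolor n) : nat := \sum_(k | cle (Some k) (Some l)) I k.
Definition sum_gt (l : scolor n) : nat := \sum_(k | clt (Some l) (Some k)) I k.
Definition sum_ge (l : scolor n) : nat := \sum_(k | cle (Some l) (Some k)) I k.
End PartialSums.

Inductive vtype := Gamma | Delta.

Section Weights.
Variables (F : fieldType) (n : nat) (q s : F).

(* bottom I, left j, top K, right l *)
Definition Lweight (x : F) (I : cvec n) (j : color n) (K : cvec n)
    (l : color n) : F :=
  if I + evec j != K + evec l then 0 else
  match l with
  | None =>
      let u := sum_unbarred I in let v := sum_barred I in
      if j == l then (q ^- u - s * x * q ^+ v) / (1 - s * x)
      else if clt j l then
        (x * q ^- u - s ^+ 2 * x * q ^+ v) / (s * (1 - s * x))
      else (q ^- u - s ^+ 2 * q ^+ v) / (1 - s * x)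
  | Some (inl _ as k) =>
      if j == l then
        (s * q ^+ I k - x) * q ^- sum_le I k / (s * (1 - s * x))
      else if clt j l then
        - x * (1 - q ^+ I k) * q ^- sum_le I k / (s * (1 - s * x))
      else - (1 - q ^+ I k) * q ^- sum_le I k / (1 - s * x)
  | Some (inr _ as k) =>
      if j == l then
        s * (s * q ^+ I k - x) * q ^+ sum_gt I k / (1 - s * x)
      else if clt j l then
        - s * x * (1 - q ^+ I k) * q ^+ sum_gt I k / (1 - s * x)
      else - s ^+ 2 * (1 - q ^+ I k) * q ^+ sum_gt I k / (1 - s * x)
  end.

(* bottom I, right j, top K, left l *)
Definition Mweight (x : F) (I : cvec n) (j : color n) (K : cvec n)
    (l : color n) : F :=
  if I + evec j != K + evec l then 0 else
  match l with
  | None =>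
      let u := sum_unbarred I in let v := sum_barred I in
      if j == l then (q ^- v - s * x * q ^+ u) / (1 - s * x)
      else if clt j l then (q ^- v - s ^+ 2 * q ^+ u) / (1 - s * x)
      else x * (s^-1 * q ^- v - s * q ^+ u) / (1 - s * x)
  | Some (inl _ as k) =>
      if j == l then
        s * (s * q ^+ I k - x) * q ^+ sum_lt I k / (1 - s * x)
      else if clt j l then
        - s ^+ 2 * (1 - q ^+ I k) * q ^+ sum_lt I k / (1 - s * x)
      else - s * x * (1 - q ^+ I k) * q ^+ sum_lt I k / (1 - s * x)
  | Some (inr _ as k) =>
      if j == l then
        (1 - s^-1 * x * q ^- I k) * q ^- sum_gt I k / (1 - s * x)
      else if clt j l then
        - (1 - q ^+ I k) * q ^- sum_ge I k / (1 - s * x)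
      else - s^-1 * x * (1 - q ^+ I k) * q ^- sum_ge I k / (1 - s * x)
  end.

(* left p, bottom I, top K, right r *)
Definition Wweight (X : vtype) (p : color n) (I K : cvec n) (r : color n)
    (z : F) : F :=
  match X with
  | Gamma => Lweight z I p K r
  | Delta => Mweight z I r K p
  end.

(* bottom-left a, top-left b, top-right c, bottom-right d *)
Definition R_GammaGamma (a b c d : color n) (x y : F) : F :=
  if [&& a == b, b == c & c == d] then 1
  else if (a == c) && (b == d) then
    if clt a b then (x - y) / (x - q * y) else q * (x - y) / (x - q * y)
  else if (a == d) && (b == c) then
    if clt b a then (1 - q) * x / (x - q * y) else (1 - q) * y / (x - q * y)
  else 0.

Definition R_DeltaGamma (a b c d : color n) (x y : F) : F :=
  if [&& a == b, b == c & c == d] then 1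
  else if (a == c) && (b == d) then
    if clt a b then (q * x * y - 1) / (x * y - 1)
    else (q * x * y - 1) / (q * (x * y - 1))
  else if (a == b) && (c == d) then
    if clt c a then (1 - q) / (q * (x * y - 1))
    else (1 - q) * x * y / (x * y - 1)
  else 0.

Definition R_DeltaDelta (a b c d : color n) (x y : F) : F :=
  if [&& a == b, b == c & c == d] then 1
  else if (a == c) && (b == d) then
    if clt a b then (y - x) / (y - q * x) else q * (y - x) / (y - q * x)
  else if (a == d) && (b == c) then
    if clt b a then (1 - q) * x / (y - q * x) else (1 - q) * y / (y - q * x)
  else 0.

(* There is no Gamma-Delta vertex; the value 0 in that case is a dummy. *)
Definition Rweight (X Y : vtype) (a b c d : color n) (x y : F) : F :=
  match X, Y with
  | Gamma, Gamma => R_GammaGamma a b c d x y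
  | Delta, Gamma => R_DeltaGamma a b c d x y
  | Delta, Delta => R_DeltaDelta a b c d x y
  | Gamma, Delta => 0
  end.

(* The x,y-dependent factor of the denominators of [Rweight X Y]; the other
   possible factor is q. *)
Definition Rdenom (X Y : vtype) (x y : F) : F :=
  match X, Y with
  | Gamma, Gamma => x - q * y
  | Delta, Gamma => x * y - 1
  | Delta, Delta => y - q * x
  | Gamma, Delta => 1
  end.

(* Hence sums of these weights over the top vector have finite support, as the
   operator \sum_(K \in [set: cvec n]) requires in order to be meaningful. *)
Lemma Wweight_finite_support (X : vtype) (p : color n) (I : cvec n)
    (r : color n) (z : F) :
  finite_set [set K : cvec n | Wweight X p I K r z != 0].
Proof.
pose u := if X is Gamma then p else r; pose v := if X is Gamma then r else p.
apply: (@sub_finite_set _ _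
  [set ([ffun k => (I k + evec u k - evec v k)%N] : cvec n)]);
  last exact: finite_set1.
move=> K /= hK; have /ffunP e : I + evec u = K + evec v.
  apply/eqP; apply: contraNT hK; rewrite /u /v.
  by case: (X) => /= ne; rewrite /Lweight /Mweight ne.
apply/ffunP=> k; have := e k; rewrite !ffunE => ek.
have {}ek : (I k + (u == Some k) = K k + (v == Some k))%N by [].
by rewrite ek addnK.
Qed.

End Weights.

(* Main.v *)
(* Give the color 0 the charge s^-2 q^(-|I|): then all 2n+1 colors play the same
   role, and the weights become functions of the ranks of the colors and of the
   prefix products P_k of the charges, with P_0 = 1 and P_(2n+1) = s^-2.  For
   (Gamma, Gamma) and (Delta, Delta) color conservation leaves two terms on each
   side, and the identity is checked on each relative order of the ranks of a, b,
   d, e.  For (Delta, Gamma) a full sum over the colors remains on the left when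
   a = b and on the right when d = e; its summand is piecewise a constant times
   P_k - P_(k+1) or 1/P_k - 1/P_(k+1), so the sum telescopes, and the relation
   P_(2n+1) = s^-2 closes the identity. *)
Require Import Defs.
From mathcomp Require Import all_boot all_order all_algebra.
From mathcomp Require Import all_classical all_reals.
From mathcomp Require Import zify ring.

Set Implicit Arguments.
Unset Strict Implicit.
Unset Printing Implicit Defensive.

Import Order.TTheory GRing.Theory Num.Theory.
Local Open Scope classical_set_scope.
Local Open Scope ring_scope.

(** * Yang-Baxter identities for weights in rank form *)

Section Core.
Variable F : fieldType.
Implicit Types (P : nat -> F) (q s x y z : F) (a b d e j l k : nat).

(* Up to a constant, the Gamma and Delta weights of a vertex with incoming color
   of rank [j] and outgoing color of rank [l]; the charge of the color of rank
   [k] is [P k.+1 / P k], so that [P] is the sequence of prefix products. *)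
Definition gweight s z P j l : F :=
  (s - z) *+ (j == l) / P l.+1
  - (if (j < l)%N then z else s) * ((P l.+1)^-1 - (P l)^-1).

Definition dweight s z P j l : F :=
  (s - z) *+ (j == l) * P l
  - (if (j <= l)%N then s else z) * (P l - P l.+1).

(** The prefix products after a color of rank [j] enters and one of rank [l] leaves: the charge of
    [j] is multiplied by [q], that of [l] is divided by [q]. *)
Definition shift q P j l : nat -> F :=
  fun k => P k * q ^+ (j < k)%N / q ^+ (l < k)%N.

(** The step function is the constant [B] plus [A - B] on an initial segment. Nested steps can thus
    be peeled off one at a time, their thresholds combining through minima. *)
Lemma sum_step (m t : nat) (A B : F) (G : nat -> F) :
  \sum_(k < m) (if (k < t)%N then A else B) * G k =
  B * (\sum_(k < m) G k) + (A - B) * (\sum_(k < minn m t) G k).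
Proof.
elim: m => [|m IH]; first by rewrite min0n !big_ord0 !mulr0 addr0.
rewrite !big_ord_recr /= IH; case: (ltnP m t) => h.
  by rewrite (minn_idPl h) big_ord_recr /=; ring.
by rewrite (minn_idPr (leqW h)); ring.
Qed.

Lemma sum_telescope (m : nat) P :
  \sum_(k < m) (P k - P k.+1) = P 0%N - P m.
Proof.
elim: m => [|m IH]; first by rewrite big_ord0 subrr.
by rewrite big_ord_recr /= IH; ring.
Qed.

Ltac cmp a b := case: (ltngtP a b) => ?; try (exfalso; lia).

(** [P] occurs only at [d], [d.+1], [e], [e.+1], and for each order of the ranks the identity is
    rational in these values taken as independent unknowns. The denominator [x - q * y] of the
    R-weights is cleared. *)
Lemma yb_GammaGamma a b d e : forall q s x y P,
  q != 0 -> (forall k, P k != 0) ->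
  (if (a <= b)%N then x - y else q * (x - y))
    * (gweight s x P b e * gweight s y (shift q P b e) a d)
  + (if (a <= b)%N then (1 - q) * y else (1 - q) * x)
    * (gweight s x P a e * gweight s y (shift q P a e) b d)
  = (if (d <= e)%N then x - y else q * (x - y))
    * (gweight s y P a d * gweight s x (shift q P a d) b e)
  + (if (e <= d)%N then (1 - q) * y else (1 - q) * x)
    * (gweight s y P a e * gweight s x (shift q P a e) b d).
Proof.
rewrite /gweight /shift !ltnS ?leqnn ?ltnn.
cmp a b; cmp a d; cmp b d; cmp a e; cmp b e; cmp d e; subst;
  move=> q s x y P hq hP; rewrite ?ltnn ?leqnn ?mulr1n ?mulr0n ?expr1 ?expr0;
  by field; rewrite ?hq ?hP ?oner_neq0.
Qed.

Lemma yb_DeltaDelta a b d e : forall q s x y P,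
  q != 0 -> (forall k, P k != 0) ->
  (if (a <= b)%N then y - x else q * (y - x))
    * (dweight s x P e b * dweight s y (shift q P e b) d a)
  + (if (b <= a)%N then (1 - q) * x else (1 - q) * y)
    * (dweight s x P e a * dweight s y (shift q P e a) d b)
  = (if (d <= e)%N then y - x else q * (y - x))
    * (dweight s y P d a * dweight s x (shift q P d a) e b)
  + (if (d <= e)%N then (1 - q) * x else (1 - q) * y)
    * (dweight s y P e a * dweight s x (shift q P e a) d b).
Proof.
rewrite /dweight /shift !ltnS ?leqnn ?ltnn.
cmp a b; cmp a d; cmp b d; cmp a e; cmp b e; cmp d e; subst;
  move=> q s x y P hq hP; rewrite ?ltnn ?leqnn ?mulr1n ?mulr0n ?expr1 ?expr0;
  by field; rewrite ?hq ?hP ?oner_neq0.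
Qed.

(** One use of [sum_step] per step function leaves telescoping sums. The minimum of the three
    thresholds is written with an [if] so that only pairwise comparisons occur. *)
Lemma sum_step3_telescope (N t1 t2 t3 : nat) (A1 B1 A2 B2 A3 B3 : F) P :
  (t1 < N)%N -> (t2 < N)%N -> (t3 < N)%N ->
  \sum_(k < N) (if (k < t1)%N then A1 else B1)
    * ((if (k < t2)%N then A2 else B2)
      * ((if (k < t3)%N then A3 else B3) * (P k - P k.+1)))
  = B1 * (B2 * (B3 * (P 0%N - P N) + (A3 - B3) * (P 0%N - P t3))
          + (A2 - B2) * (B3 * (P 0%N - P t2)
                         + (A3 - B3) * (P 0%N - P (minn t2 t3))))
    + (A1 - B1) * (B2 * (B3 * (P 0%N - P t1)
                         + (A3 - B3) * (P 0%N - P (minn t1 t3)))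
          + (A2 - B2) * (B3 * (P 0%N - P (minn t1 t2))
                         + (A3 - B3) * (P 0%N
            - P (if (t1 < t2)%N then minn t1 t3 else minn t2 t3)))).
Proof.
move=> t1N t2N t3N.
have mN t : (t < N)%N -> minn N t = t by move=> /ltnW/minn_idPr.
pose G3 k := (if (k < t3)%N then A3 else B3) * (P k - P k.+1).
pose G2 k := (if (k < t2)%N then A2 else B2) * G3 k.
rewrite (sum_step _ _ _ _ G2) /G2 !(sum_step _ _ _ _ G3) /G3.
rewrite -(fun_if (minn^~ t3)) -/(minn t1 t2).
by rewrite !(sum_step _ _ _ _ (fun k => P k - P k.+1)) !sum_telescope !mN.
Qed.

(* Off the ranks [d] and [e] the summand is a step function of [g] times
   [P g - P g.+1]; the first two terms are the corrections at [e] and [d]. *)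
Lemma sum_dweight_gweight N a d e q s x y P A B :
  q != 0 -> (forall k, P k != 0) -> (d < N)%N -> (e < N)%N ->
  let p k := (P k * q ^+ (e < k)%N)^-1 in
  let T k := if (k < a)%N then A else B in
  let Sx k := if (k < e)%N then x else s in
  let Sy k := if (k < d)%N then y * q else s in
  \sum_(g < N) T g * (dweight s x P e g * gweight s y (shift q P e g) g d)
  = T e * (s - x) * P e
      * ((s - y * q) *+ (e == d) * p d.+1 - Sy e * (p d.+1 - p d))
    - T d * Sx d * (P d - P d.+1) * (s - y * q) * p d.+1
    + (p d.+1 - p d) * \sum_(g < N) T g * (Sx g * (Sy g * (P g - P g.+1))).
Proof.
move=> hq hP dN eN p T Sx Sy.
(* For [g < k] the departure of [g] divides the shifted prefix product by [q]. Absorbing this [q]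
   into [y] leaves [p], which does not depend on [g]. *)
have gE g : gweight s y (shift q P e g) g d
    = (s - y * q) *+ (g == d) * p d.+1 - Sy g * (p d.+1 - p d).
  rewrite /gweight /shift /p /Sy !ltnS.
  by case: (ltngtP g d) => ?; case: (leqP e d) => ?; case: (ltnP e d) => ?;
    rewrite ?mulr1n ?mulr0n ?expr1 ?expr0; field; rewrite ?hq ?hP ?oner_neq0.
have dE g : dweight s x P e g
    = (s - x) *+ (e == g) * P g - Sx g * (P g - P g.+1).
  by rewrite /dweight /Sx leqNgt; case: ltnP.
rewrite (eq_bigr (fun g : 'I_N =>
  (if g == Ordinal eN then T e * (s - x) * P e
      * ((s - y * q) *+ (e == d) * p d.+1 - Sy e * (p d.+1 - p d)) else 0)
  - (if g == Ordinal dN then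
       T d * Sx d * (P d - P d.+1) * (s - y * q) * p d.+1 else 0)
  + (p d.+1 - p d) * (T g * (Sx g * (Sy g * (P g - P g.+1)))))).
  by rewrite big_split sumrB -!big_mkcond !big_pred1_eq mulr_sumr.
move=> g _; rewrite gE dE -!val_eqE /= eq_sym.
by case: eqP => [->|_]; case: eqP => [->|_]; rewrite ?mulr1n ?mulr0n; ring.
Qed.

(** The counterpart for the right-hand side: the reciprocals of [P] telescope, and the [q] coming
    from the departure of [l] divides [s] instead of multiplying [y]. *)
Lemma sum_gweight_dweight N a b d q s x y P A B :
  q != 0 -> (forall k, P k != 0) -> (a < N)%N -> (b < N)%N ->
  let p k := P k * q ^+ (a < k)%N in
  let T k := if (k < d)%N then A else B in
  let Sx k := if (k < b)%N then s / q else x in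
  let Sy k := if (k < a)%N then s else y in
  \sum_(l < N) T l * (gweight s y P a l * dweight s x (shift q P a l) l b)
  = T a * (s - y) / P a
      * ((s / q - x) *+ (a == b) * p b.+1 - Sx a * (p b - p b.+1))
    + T b * Sy b * ((P b)^-1 - (P b.+1)^-1) * (s / q - x) * p b.+1
    - (p b - p b.+1)
      * \sum_(l < N) T l * (Sx l * (Sy l * ((P l)^-1 - (P l.+1)^-1))).
Proof.
move=> hq hP aN bN p T Sx Sy.
have dE l : dweight s x (shift q P a l) l b
    = (s / q - x) *+ (l == b) * p b.+1 - Sx l * (p b - p b.+1).
  rewrite /dweight /shift /p /Sx !ltnS.
  by case: (ltngtP l b) => ?; case: (leqP a b) => ?; case: (ltnP a b) => ?;
    rewrite ?mulr1n ?mulr0n ?expr1 ?expr0; field; rewrite ?hq ?hP ?oner_neq0.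
(* Taking the diagonal term at [P l] instead of [P l.+1] changes the value at [l = a] from [s] to
   [y], which makes the threshold the strict [l < a]. *)
have gE l : gweight s y P a l
    = (s - y) *+ (a == l) / P l + Sy l * ((P l)^-1 - (P l.+1)^-1).
  by rewrite /gweight /Sy; case: ltngtP => ?;
    rewrite ?mulr1n ?mulr0n; field; rewrite ?hq ?hP.
rewrite (eq_bigr (fun l : 'I_N =>
  (if l == Ordinal aN then T a * (s - y) / P a
      * ((s / q - x) *+ (a == b) * p b.+1 - Sx a * (p b - p b.+1)) else 0)
  + (if l == Ordinal bN then
       T b * Sy b * ((P b)^-1 - (P b.+1)^-1) * (s / q - x) * p b.+1 else 0)
  - (p b - p b.+1) * (T l * (Sx l * (Sy l * ((P l)^-1 - (P l.+1)^-1)))))).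
  by rewrite sumrB big_split -!big_mkcond !big_pred1_eq mulr_sumr.
move=> l _; rewrite gE dE -!val_eqE /= eq_sym.
by case: eqP => [->|_]; case: eqP => [->|_]; rewrite ?mulr1n ?mulr0n; ring.
Qed.

(** The denominator [q * (x * y - 1)] is cleared. When [a = b], the first term and the summand
    [g = a] carry the same product, and their coefficients add up to this denominator; likewise for
    [d = e] and [l = d]. *)
Lemma yb_DeltaGamma N a b d e : (a < N)%N -> (b < N)%N -> (d < N)%N ->
  (e < N)%N -> forall q s x y P,
  q != 0 -> s != 0 -> (forall k, P k != 0) -> P 0%N = 1 -> P N = s ^- 2 ->
  (if (a <= b)%N then q * (q * x * y - 1) else q * x * y - 1)
    * (dweight s x P e b * gweight s y (shift q P e b) a d)
  + (if a == b then \sum_(g < N)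
       (if (g < a)%N then 1 - q else (1 - q) * q * x * y)
         * (dweight s x P e g * gweight s y (shift q P e g) g d) else 0)
  = (if (d < e)%N then q * (q * x * y - 1) else q * x * y - 1)
    * (gweight s y P a d * dweight s x (shift q P a d) e b)
  + (if d == e then \sum_(l < N)
       (if (l < d)%N then (1 - q) * q * x * y else 1 - q)
         * (gweight s y P a l * dweight s x (shift q P a l) l b) else 0).
Proof.
move=> aN bN dN eN q s x y P hq hs hP P0 PN.
rewrite sum_dweight_gweight // sum_gweight_dweight // sum_step3_telescope //.
rewrite (sum_step3_telescope _ _ _ _ _ _ (fun k => (P k)^-1)) //.
(* The sums are now in closed form. Once the endpoint values are inserted, the remaining values of
   [P] act as independent unknowns. *)
rewrite P0 PN; move: hq hs hP; clear -F.
rewrite /gweight /dweight /shift !ltnS ?leqnn ?ltnn.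
move: q s x y P.
cmp a b; cmp a d; cmp d b; cmp e a; cmp e d; cmp b e; subst;
  move=> q s x y P hq hs hP;
  rewrite ?ltnn ?leqnn ?minnn ?mulr1n ?mulr0n ?expr1 ?expr0;
  by field; rewrite ?hs ?hq ?hP ?oner_neq0.
Qed.
End Core.

(** * Charges and the uniform formula for the vertex weights *)

Section Uniform.
Variables (F : fieldType) (n : nat) (q s : F).
Implicit Types (I K f c h : cvec n) (j l p r : color n) (z : F).

(* A color k other than 0 has charge q^(I_k), and the color 0 has the charge
   s^-2 q^(-|I|), making the product of all the charges s^-2.  With it the
   weights for the color 0 obey the same formulas as the others. *)
Definition charge_prefix I (m : nat) : F :=
  if (m <= n)%N then q ^+ (\sum_(k | (crank (Some k) < m)%N) I k)%N
  else s ^- 2 / q ^+ (\sum_(k | (m <= crank (Some k))%N) I k)%N.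

Lemma charge_prefix0 I : charge_prefix I 0%N = 1.
Proof. by rewrite /charge_prefix leq0n big_pred0 // => k; rewrite ltn0. Qed.

Lemma ltn_crank j : (crank j < n.*2.+1)%N.
Proof. case: j => [[i|i]|] /=; try have := ltn_ord i; lia. Qed.

Lemma charge_prefix_top I : charge_prefix I n.*2.+1 = s ^- 2.
Proof.
rewrite /charge_prefix ifN; last by lia.
by rewrite big_pred0 ?divr1 // => k; rewrite leqNgt ltn_crank.
Qed.

Lemma sum_rank_leq I (k : scolor n) :
  (\sum_(k' | (crank (Some k') <= crank (Some k))%N) I k')%N
  = (\sum_(k' | (crank (Some k') < crank (Some k))%N) I k' + I k)%N.
Proof.
rewrite (bigD1 k) //= addnC; congr (_ + _)%N; apply: eq_bigl => k'.
rewrite ltn_neqAle andbC; congr (~~ _ && _).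
apply/eqP/eqP => [->//|e].
by have [] := @crank_inj n (Some _) (Some _) e.
Qed.

Lemma sum_rank_geq I (k : scolor n) :
  (\sum_(k' | (crank (Some k) <= crank (Some k'))%N) I k')%N
  = (I k + \sum_(k' | (crank (Some k) < crank (Some k'))%N) I k')%N.
Proof.
rewrite (bigD1 k) //=; congr (_ + _)%N; apply: eq_bigl => k'.
rewrite ltn_neqAle andbC eq_sym; congr (~~ _ && _).
apply/eqP/eqP => [->//|e].
by have [] := @crank_inj n (Some _) (Some _) e.
Qed.

Lemma charge_prefixS_unbarred I (i : 'I_n) :
  charge_prefix I i = q ^+ sum_lt I (inl i) /\
  charge_prefix I i.+1 = q ^+ sum_lt I (inl i) * q ^+ I (inl i).
Proof.
rewrite /charge_prefix ltn_ord ltnW ?ltn_ord //; split=> //.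
rewrite -exprD -sum_rank_leq; congr (_ ^+ _).
Qed.

Lemma charge_prefixS_barred I (i : 'I_n) : let r := (n.*2 - i)%N in
  charge_prefix I r = s ^- 2 / (q ^+ I (inr i) * q ^+ sum_gt I (inr i)) /\
  charge_prefix I r.+1 = s ^- 2 / q ^+ sum_gt I (inr i).
Proof.
rewrite /= /charge_prefix !ifN; [|have := ltn_ord i; lia..].
by rewrite -exprD -sum_rank_geq.
Qed.

(** The two branches of [charge_prefix] meet at the color 0: the ratio of these two values is its
    charge. *)
Lemma charge_prefix_zero I :
  charge_prefix I n = q ^+ sum_unbarred I /\
  charge_prefix I n.+1 = s ^- 2 / q ^+ sum_barred I.
Proof.
rewrite /charge_prefix leqnn ltnn /sum_unbarred /sum_barred.
split; [congr (_ ^+ _) | congr (_ / _ ^+ _)]; rewrite big_sumType /=.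
  rewrite [X in (_ + X)%N]big_pred0 ?addn0; last first.
    by move=> i; have := ltn_ord i; lia.
  by apply: eq_bigl => i; rewrite ltn_ord.
rewrite big_pred0 ?add0n; last by move=> i; have := ltn_ord i; lia.
by apply: eq_bigl => i; have := ltn_ord i; lia.
Qed.

(** The color 0 has rank [n] and zero [evec]; the condition on [pr] makes the right side vanish for
    it too. *)
Lemma sum_evec j (pr : pred nat) : ~~ pr n ->
  (\sum_(k | pr (crank (Some k))) evec j k)%N = pr (crank j).
Proof.
case: j => [j|] hp; last first.
  by rewrite big1 /= ?(negbTE hp) // => k _; rewrite ffunE.
case hj: (pr (crank (Some j))).
  rewrite (bigD1 j) //= ffunE eqxx big1 // => k /andP[_ kj].
  by rewrite ffunE (inj_eq Some_inj) eq_sym (negbTE kj).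
rewrite big1 // => k hk; rewrite ffunE (inj_eq Some_inj).
by case: eqP hk => // <-; rewrite hj.
Qed.

Hypotheses (hq : q != 0) (hs : s != 0).

Lemma charge_prefix_neq0 I m : charge_prefix I m != 0.
Proof.
by rewrite /charge_prefix; case: ifP => _;
  rewrite ?mulf_neq0 ?invr_neq0 ?expf_neq0.
Qed.

(** For [m <= n] the prefix counts the ranks below [m], otherwise its complement counts those from
    [m] on. Neither set contains [n], so [sum_evec] treats the color 0 like the others. *)
Lemma charge_prefix_shift I K j l : I + evec j = K + evec l ->
  charge_prefix K =1 shift q (charge_prefix I) (crank j) (crank l).
Proof.
move=> e m.
have E (pr : pred nat) : ~~ pr n ->
   (\sum_(k | pr (crank (Some k))) I k + pr (crank j) =
    \sum_(k | pr (crank (Some k))) K k + pr (crank l))%N.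
  move=> hp; rewrite -!(sum_evec _ hp) -!big_split; apply: eq_bigr => k _.
  by have /ffunP/(_ k) := e; rewrite !ffunE.
rewrite /shift /charge_prefix; case: (leqP m n) => hm.
  have := E (fun t => (t < m)%N).
  rewrite -leqNgt => /(_ hm) /(congr1 (GRing.exp q)).
  by rewrite !exprD => ->; rewrite mulfK ?expf_neq0.
have := E (fun t => (m <= t)%N).
rewrite -ltnNge => /(_ hm) /(congr1 (GRing.exp q)).
rewrite !exprD (leqNgt m (crank j)) (leqNgt m (crank l)).
move: (\sum_(k | _) I k)%N (\sum_(k | _) K k)%N => A B.
have := (expf_neq0 A hq, expf_neq0 B hq).
move: (q ^+ A) (q ^+ B) => {}A {}B [hA hB].
case: (crank j < m)%N; case: (crank l < m)%N; rewrite ?expr1 ?expr0 ?mulr1 => eAB;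
  first [rewrite eAB | rewrite -eAB | rewrite (mulIf hq eAB)];
  by field; rewrite ?hq ?hs ?hA ?hB ?oner_neq0.
Qed.

Lemma eq_crank j l : (j == l) = (crank j == crank l).
Proof. by apply/eqP/eqP => [->//|/crank_inj]. Qed.

(** The difference of reciprocal prefixes is [1 - q ^+ I k] times a power of [q], with an extra
    [s ^+ 2] for barred [k]; for the color 0 it is [s ^+ 2 * q ^+ v - q ^- u]. This accounts for the
    different powers of [s] in the nine formulas. *)
Lemma LweightE z I K j l : 1 - s * z != 0 -> Lweight q s z I j K l =
  if I + evec j == K + evec l
  then gweight s z (charge_prefix I) (crank j) (crank l) / (s * (1 - s * z))
  else 0.
Proof.
move=> hz; rewrite /Lweight; case: eqP => //= _.
rewrite eq_crank /gweight /clt.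
case: l => [[i|i]|]; rewrite /=.
- have [-> ->] := charge_prefixS_unbarred I i.
  have -> : sum_le I (inl i) = (sum_lt I (inl i) + I (inl i))%N.
    exact: sum_rank_leq.
  rewrite exprD.
  have hA := expf_neq0 (sum_lt I (inl i)) hq.
  have hB := expf_neq0 (I (inl i)) hq.
  set A := q ^+ sum_lt I (inl i) in hA *; set B := q ^+ I (inl i) in hB *.
  clearbody A B.
  case: ltngtP => _; rewrite ?mulr1n ?mulr0n; field;
    by rewrite ?hz ?hs ?hA ?hB ?oner_neq0.
- have [-> ->] := charge_prefixS_barred I i.
  have hA := expf_neq0 (sum_gt I (inr i)) hq.
  have hB := expf_neq0 (I (inr i)) hq.
  set A := q ^+ sum_gt I (inr i) in hA *; set B := q ^+ I (inr i) in hB *.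
  clearbody A B.
  case: ltngtP => _; rewrite ?mulr1n ?mulr0n; field;
    by rewrite ?hz ?hs ?hA ?hB ?oner_neq0.
- have [-> ->] := charge_prefix_zero I.
  have hA := expf_neq0 (sum_unbarred I) hq.
  have hB := expf_neq0 (sum_barred I) hq.
  set A := q ^+ sum_unbarred I in hA *; set B := q ^+ sum_barred I in hB *.
  clearbody A B.
  case: ltngtP => _; rewrite ?mulr1n ?mulr0n; field;
    by rewrite ?hz ?hs ?hA ?hB ?oner_neq0.
Qed.

Lemma MweightE z I K j l : 1 - s * z != 0 -> Mweight q s z I j K l =
  if I + evec j == K + evec l
  then s ^+ 2 * dweight s z (charge_prefix I) (crank j) (crank l)
         / (s * (1 - s * z))
  else 0.
Proof.
move=> hz; rewrite /Mweight; case: eqP => //= _.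
rewrite eq_crank /dweight /clt.
case: l => [[i|i]|]; rewrite /=.
- have [-> ->] := charge_prefixS_unbarred I i.
  have hA := expf_neq0 (sum_lt I (inl i)) hq.
  have hB := expf_neq0 (I (inl i)) hq.
  set A := q ^+ sum_lt I (inl i) in hA *; set B := q ^+ I (inl i) in hB *.
  clearbody A B.
  case: ltngtP => _; rewrite ?mulr1n ?mulr0n; field;
    by rewrite ?hz ?hs ?hA ?hB ?oner_neq0.
- have [-> ->] := charge_prefixS_barred I i.
  have -> : sum_ge I (inr i) = (I (inr i) + sum_gt I (inr i))%N.
    exact: sum_rank_geq.
  rewrite exprD.
  have hA := expf_neq0 (sum_gt I (inr i)) hq.
  have hB := expf_neq0 (I (inr i)) hq.
  set A := q ^+ sum_gt I (inr i) in hA *; set B := q ^+ I (inr i) in hB *.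
  clearbody A B.
  case: ltngtP => _; rewrite ?mulr1n ?mulr0n; field;
    by rewrite ?hz ?hs ?hA ?hB ?oner_neq0.
- have [-> ->] := charge_prefix_zero I.
  have hA := expf_neq0 (sum_unbarred I) hq.
  have hB := expf_neq0 (sum_barred I) hq.
  set A := q ^+ sum_unbarred I in hA *; set B := q ^+ sum_barred I in hB *.
  clearbody A B.
  case: ltngtP => _; rewrite ?mulr1n ?mulr0n; field;
    by rewrite ?hz ?hs ?hA ?hB ?oner_neq0.
Qed.

End Uniform.

(** Color enters a Gamma vertex from the left and a Delta vertex from the right. The type is
    arbitrary so as to cover both colors and ranks. *)
Definition edge_in (X : vtype) (T : Type) (p r : T) :=
  if X is Gamma then p else r.
Definition edge_out (X : vtype) (T : Type) (p r : T) :=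
  if X is Gamma then r else p.

(** * Two stacked vertices and the vector between them *)

Section YangBaxter.
Variables (F : fieldType) (n : nat) (q s : F).
Hypotheses (hq : q != 0) (hs : s != 0).
Implicit Types (I K f c h : cvec n) (j l p r a b d e g i : color n).
Implicit Types (x y z : F) (X Y : vtype).

Definition uweight X z (P : nat -> F) (p r : nat) : F :=
  match X with
  | Gamma => gweight s z P p r
  | Delta => dweight s z P r p
  end.

(** The Delta entry absorbs the factor [s ^+ 2] of [MweightE]. *)
Definition vdenom X z : F :=
  match X with
  | Gamma => s * (1 - s * z)
  | Delta => (1 - s * z) / s
  end.

Lemma eq_uweight X z (P P' : nat -> F) (p r : nat) :
  P =1 P' -> uweight X z P p r = uweight X z P' p r.
Proof. by case: X => eP; rewrite /= /gweight /dweight !eP. Qed.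

Lemma WweightE X z p I K r : 1 - s * z != 0 -> Wweight q s X p I K r z =
  if I + evec (edge_in X p r) == K + evec (edge_out X p r)
  then uweight X z (charge_prefix q s I) (crank p) (crank r)
         / vdenom X z
  else 0.
Proof.
case: X => hz; rewrite /= (LweightE, MweightE) //.
by case: ifP => // _; field; rewrite hs hz.
Qed.

Lemma cvec_addIr c : injective (fun I => I + c).
Proof.
move=> I K /ffunP e; apply/ffunP=> k; have := e k; rewrite !ffunE.
exact: addIn.
Qed.

(** A color [w] that leaves one vertex and enters the other drops out of the total conservation
    condition. *)
Lemma eq_cvec_addr f c (u v w : cvec n) :
  (f + (u + w) == c + (w + v)) = (f + u == c + v).
Proof.
by rewrite [w + v]addrC !addrA; apply/eqP/eqP => [/cvec_addIr //|->].
Qed.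

(* When no top vector exists, the outgoing color is absent from [I] and the
   factor 1 - q^(I_k) vanishes. *)
Lemma uweight_empty X z p I r (k : scolor n) :
  edge_out X p r = Some k -> edge_in X p r != Some k -> I k = 0%N ->
  uweight X z (charge_prefix q s I) (crank p) (crank r) = 0.
Proof.
move=> ho hi Ik.
have e : charge_prefix q s I (crank (Some k)).+1
         = charge_prefix q s I (crank (Some k)).
  case: k Ik {ho hi} => k Ik /=.
    by have [-> ->] := charge_prefixS_unbarred q s I k; rewrite Ik mulr1.
  by have [-> ->] := charge_prefixS_barred q s I k; rewrite Ik mul1r.
case: X ho hi => /= -> hi; rewrite /uweight /gweight /dweight e -eq_crank;
  by rewrite (negbTE hi) !mul0r !subrr ?mulr0 ?subrr ?mulr0.
Qed.

Lemma fsum_supp1 (h0 : cvec n) (G : cvec n -> F) :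
  (forall h, h != h0 -> G h = 0) -> \sum_(h \in [set: cvec n]) G h = G h0.
Proof.
move=> hG; rewrite -[RHS](@fsbig_set1 F 0 +%R _ h0); apply/esym/fsbig_widen.
  by [].
move=> h /= [_ hh].
by apply: hG; apply/eqP => e; apply: hh.
Qed.

(** Conservation at the first vertex leaves at most one middle vector. If there is none, the closed
    form still holds, since [uweight_empty] makes it zero. *)
Lemma fsum_Wweight X Y p r p' r' f c z z' :
  1 - s * z != 0 -> 1 - s * z' != 0 ->
  \sum_(h \in [set: cvec n])
     Wweight q s X p f h r z * Wweight q s Y p' h c r' z'
  = if f + (evec (edge_in X p r) + evec (edge_in Y p' r'))
       == c + (evec (edge_out X p r) + evec (edge_out Y p' r'))
    then uweight X z (charge_prefix q s f) (crank p) (crank r)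
         * uweight Y z' (shift q (charge_prefix q s f)
              (edge_in X (crank p) (crank r)) (edge_out X (crank p) (crank r)))
             (crank p') (crank r') / (vdenom X z * vdenom Y z')
    else 0.
Proof.
move=> hz hz'.
have hin : edge_in X (crank p) (crank r) = crank (edge_in X p r) by case: X.
have hout : edge_out X (crank p) (crank r) = crank (edge_out X p r) by case: X {hin}.
rewrite hin hout.
set u := edge_in X p r; set v := edge_out X p r.
set u' := edge_in Y p' r'; set v' := edge_out Y p' r'.
have [[h0 e0]|no] := pselect (exists h, f + evec u = h + evec v).
  rewrite (fsum_supp1 (h0 := h0)); last first.
    move=> h hh; rewrite WweightE // ifN ?mul0r // -/u -/v e0.
    by apply: contraNneq hh => /cvec_addIr ->.
  rewrite !WweightE // -/u -/v -/u' -/v' e0 eqxx.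
  have -> : (f + (evec u + evec u') == c + (evec v + evec v'))
            = (h0 + evec u' == c + evec v').
    rewrite !addrA e0 [h0 + _ + _]addrAC [c + _ + _]addrAC.
    by apply/eqP/eqP => [/cvec_addIr //|->].
  case: ifP => _; last by rewrite mulr0.
  have eP := charge_prefix_shift hq hs e0.
  have -> : uweight Y z' (charge_prefix q s h0) (crank p') (crank r')
    = uweight Y z' (shift q (charge_prefix q s f) (crank u) (crank v))
         (crank p') (crank r').
    exact: eq_uweight.
  by rewrite mulrACA -invfM.
rewrite fsbig1; last first.
  move=> h _; rewrite WweightE // ifN ?mul0r //.
  by apply/eqP => e; apply: no; exists h.
case: ifP => // _.
(* The middle vector can only be missing because the outgoing color is nonzero, differs from the
   incoming one and is absent from [f]. *)
suff [k [hv hu fk]] : exists k, [/\ v = Some k, u != Some k & f k = 0%N].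
  by rewrite (uweight_empty z hv hu fk) !mul0r.
case ev: v => [k|]; last first.
  case: no; exists (f + evec u); apply/ffunP => k; rewrite ev !ffunE.
  by rewrite [RHS]addn0.
exists k; split=> //.
  apply/eqP => eu; case: no; exists f; by rewrite ev eu.
apply/eqP; rewrite -leqn0 leqNgt; apply/negP => fk; case: no.
(* The truncated subtraction is exact because [f k] is positive. *)
exists [ffun k' => (f k' + evec u k' - evec v k')%N]; apply/ffunP => k'.
rewrite ev !ffunE.
suff : ((Some k == Some k' :> color n) <= f k')%N.
  move: (nat_of_bool (Some k == Some k')) (nat_of_bool (u == Some k')) (f k').
  move=> A B C ?; change ((C + B)%N = (C + B - A + A)%N); lia.
by case: eqP => // -[<-].
Qed.

(** * Sums over colors *)

Lemma sum_crank (G : nat -> F) :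
  \sum_(g : color n) G (crank g) = \sum_(k < n.*2.+1) G k.
Proof.
pose t (g : color n) : 'I_n.*2.+1 := Ordinal (ltn_crank g).
rewrite (reindex t) //; apply: onW_bij; apply: inj_card_bij.
  by move=> g g' /(congr1 val)/crank_inj.
by rewrite card_ord card_option card_sum card_ord addnn.
Qed.

Lemma sum_pair_eq a b (H : color n -> color n -> F) :
  \sum_g \sum_i ((a == g) && (b == i))%:R * H g i = H a b.
Proof.
rewrite (bigD1 a) //= [X in _ + X]big1 ?addr0 => [|g ga]; last first.
  by apply: big1 => i _; rewrite eq_sym (negbTE ga) mul0r.
rewrite (bigD1 b) //= !eqxx mul1r big1 ?addr0 // => i ib.
by rewrite [b == i]eq_sym (negbTE ib) mul0r.
Qed.

Lemma sum_diag_eq (H : color n -> color n -> F) :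
  \sum_g \sum_i (g == i)%:R * H g i = \sum_g H g g.
Proof.
apply: eq_bigr => g _; rewrite (bigD1 g) //= eqxx mul1r big1 ?addr0 // => i ig.
by rewrite eq_sym (negbTE ig) mul0r.
Qed.

(** * R-weights as combinations of Kronecker deltas *)

Ltac rank_cases a b c d :=
  rewrite /clt !eq_crank;
  move: (crank a) (crank b) (crank c) (crank d) => {}a {}b {}c {}d;
  case: (ltngtP a b) => ?; case: (b =P c) => ?; try (exfalso; lia);
  case: (c =P d) => ?; try (exfalso; lia);
  case: (ltngtP a c) => ?; try (exfalso; lia);
  case: (b =P d) => ?; try (exfalso; lia);
  case: (a =P d) => ?; try (exfalso; lia).

(* In these decompositions both terms contribute when a = b = c = d, and the
   coefficients on the diagonal are chosen to add up to 1. *)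
Lemma R_GammaGammaE (a b c d : color n) x y : x - q * y != 0 ->
  R_GammaGamma q a b c d x y =
  (if (crank a <= crank b)%N then x - y else q * (x - y)) / (x - q * y)
    * ((a == c) && (b == d))%:R
  + (if (crank a <= crank b)%N then (1 - q) * y else (1 - q) * x) / (x - q * y)
    * ((b == c) && (a == d))%:R.
Proof.
move: x y; rewrite /R_GammaGamma; rank_cases a b c d; move=> x y hD.
all: rewrite /= ?mul1r ?mul0r ?mulr1 ?mulr0 ?addr0 ?add0r //.
all: by field.
Qed.

Lemma R_DeltaDeltaE (a b c d : color n) x y : y - q * x != 0 ->
  R_DeltaDelta q a b c d x y =
  (if (crank a <= crank b)%N then y - x else q * (y - x)) / (y - q * x)
    * ((a == c) && (b == d))%:R
  + (if (crank b <= crank a)%N then (1 - q) * x else (1 - q) * y) / (y - q * x)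
    * ((b == c) && (a == d))%:R.
Proof.
move: x y; rewrite /R_DeltaDelta; rank_cases a b c d; move=> x y hD.
all: rewrite /= ?mul1r ?mul0r ?mulr1 ?mulr0 ?addr0 ?add0r //.
all: by field.
Qed.

Lemma R_DeltaGammaE (a b c d : color n) x y : x * y - 1 != 0 ->
  R_DeltaGamma q a b c d x y =
  (if (crank a <= crank b)%N then q * (q * x * y - 1) else q * x * y - 1)
    / (q * (x * y - 1)) * ((a == c) && (b == d))%:R
  + (a == b)%:R * ((if (crank c < crank a)%N then 1 - q else (1 - q) * q * x * y)
    / (q * (x * y - 1))) * (c == d)%:R.
Proof.
move: x y; rewrite /R_DeltaGamma; rank_cases a b c d; move=> x y hD.
all: rewrite /= ?mul1r ?mul0r ?mulr1 ?mulr0 ?addr0 ?add0r //.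
all: by field; rewrite hq hD.
Qed.

(** Here the coefficients depend on [c] and [d], the edges that stay fixed on the right-hand side of
    the equation while [a] and [b] are summed. *)
Lemma R_GammaGammaE' (a b c d : color n) x y : x - q * y != 0 ->
  R_GammaGamma q a b c d x y =
  (if (crank c <= crank d)%N then x - y else q * (x - y)) / (x - q * y)
    * ((c == a) && (d == b))%:R
  + (if (crank d <= crank c)%N then (1 - q) * y else (1 - q) * x) / (x - q * y)
    * ((d == a) && (c == b))%:R.
Proof.
move=> hD; rewrite R_GammaGammaE // !(eq_sym c) !(eq_sym d) [(b == c) && _]andbC.
by congr (_ + _); [case: eqP => [->|_] | case: eqP => [->|_]];
  rewrite ?mulr0 //; case: eqP => [->|_]; rewrite ?mulr0.
Qed.

Lemma R_DeltaDeltaE' (a b c d : color n) x y : y - q * x != 0 ->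
  R_DeltaDelta q a b c d x y =
  (if (crank c <= crank d)%N then y - x else q * (y - x)) / (y - q * x)
    * ((c == a) && (d == b))%:R
  + (if (crank c <= crank d)%N then (1 - q) * x else (1 - q) * y) / (y - q * x)
    * ((d == a) && (c == b))%:R.
Proof.
move=> hD; rewrite R_DeltaDeltaE // !(eq_sym c) !(eq_sym d) [(b == c) && _]andbC.
by congr (_ + _); [case: eqP => [->|_] | case: eqP => [->|_]];
  rewrite ?mulr0 //; case: eqP => [->|_]; rewrite ?mulr0.
Qed.

(** The diagonal is split otherwise than in [R_DeltaGammaE], into [q * x * y - 1] and [1 - q], so
    that the second coefficient is a strict step in the summed rank, as in [yb_DeltaGamma]. *)
Lemma R_DeltaGammaE' (a b c d : color n) x y : x * y - 1 != 0 ->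
  R_DeltaGamma q a b c d x y =
  (if (crank c < crank d)%N then q * (q * x * y - 1) else q * x * y - 1)
    / (q * (x * y - 1)) * ((c == a) && (d == b))%:R
  + (c == d)%:R * ((if (crank a < crank c)%N then (1 - q) * q * x * y else 1 - q)
    / (q * (x * y - 1))) * (a == b)%:R.
Proof.
rewrite (eq_sym c a) (eq_sym d b).
move: x y; rewrite /R_DeltaGamma; rank_cases a b c d; move=> x y hD.
all: case: (ltngtP c d) => ?; try (exfalso; lia).
all: rewrite /= ?mul1r ?mul0r ?mulr1 ?mulr0 ?addr0 ?add0r //.
all: by field; rewrite hq hD.
Qed.

(** * Assembly of the equation *)

Lemma fsum_scalel (w : F) (u v : cvec n -> F) :
  \sum_(h \in [set: cvec n]) w * u h * v h
  = w * \sum_(h \in [set: cvec n]) u h * v h.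
Proof. by rewrite mulr_fsumr; apply: eq_fsbigr => h _; rewrite mulrA. Qed.

Lemma fsum_scaler (w : F) (u v : cvec n -> F) :
  \sum_(h \in [set: cvec n]) u h * v h * w
  = w * \sum_(h \in [set: cvec n]) u h * v h.
Proof. by rewrite mulr_fsumr; apply: eq_fsbigr => h _; rewrite mulrC. Qed.

Lemma sum_swap_eq (A B : F) a b (H : color n -> color n -> F) :
  \sum_g \sum_i (A * ((a == g) && (b == i))%:R
                 + B * ((b == g) && (a == i))%:R) * H g i
  = A * H a b + B * H b a.
Proof.
rewrite -(sum_pair_eq a b) -(sum_pair_eq b a) !mulr_sumr -big_split.
apply: eq_bigr => g _; rewrite !mulr_sumr -big_split.
by apply: eq_bigr => i _ /=; ring.
Qed.

Lemma sum_pair_diag_eq (A : F) (B : color n -> F) a b (t : bool)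
    (H : color n -> color n -> F) :
  \sum_g \sum_i (A * ((a == g) && (b == i))%:R + t%:R * B g * (g == i)%:R) * H g i
  = A * H a b + (if t then \sum_g B g * H g g else 0).
Proof.
have -> : (if t then \sum_g B g * H g g else 0)
    = \sum_g \sum_i (g == i)%:R * (t%:R * B g * H g i).
  rewrite sum_diag_eq; case: t; first by apply: eq_bigr => g _; rewrite mul1r.
  by rewrite big1 // => g _; rewrite !mul0r.
rewrite -(sum_pair_eq a b) !mulr_sumr -big_split.
apply: eq_bigr => g _; rewrite !mulr_sumr -big_split.
by apply: eq_bigr => i _ /=; ring.
Qed.

(** [N] stands for the denominator of the R-weights and [S] for that of the two vertex weights;
    clearing both leaves a rank identity. *)
Lemma eq_two_terms (A B C D u v w t N S : F) :
  A * u + B * v = C * w + D * t ->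
  A / N * (u / S) + B / N * (v / S) = C / N * (w / S) + D / N * (t / S).
Proof. by move=> e; rewrite !mulf_div -!mulrDl e. Qed.

Lemma sum_diag_scale (t C : bool) (cond : color n -> bool) (B U : nat -> F)
    (N S : F) : (t -> forall g, cond g = C) ->
  (if t then \sum_g B (crank g) / N * (if cond g then U (crank g) / S else 0)
   else 0)
  = if C then 1 / N * ((if t then \sum_(k < n.*2.+1) B k * U k else 0) / S)
    else 0.
Proof.
case: t => [/(_ isT) hC|_]; last by rewrite mul0r mulr0 if_same.
rewrite -(sum_crank (fun k => B k * U k)) mulr_suml mulr_sumr.
case: C hC => hC; last by apply: big1 => g _; rewrite hC mulr0.
by apply: eq_bigr => g _; rewrite hC !mulf_div mul1r.
Qed.

Lemma yang_baxter X Y (a b d e : color n) f c x y :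
  [\/ (X, Y) = (Gamma, Gamma), (X, Y) = (Delta, Gamma)
     | (X, Y) = (Delta, Delta)] ->
  1 - s * x != 0 -> 1 - s * y != 0 -> Rdenom q X Y x y != 0 ->
  \sum_(g : color n) \sum_(i : color n) \sum_(h \in [set: cvec n])
     Rweight q X Y a b g i x y * Wweight q s X i f h e x
       * Wweight q s Y g h c d y
  = \sum_(j : color n) \sum_(l : color n) \sum_(k \in [set: cvec n])
     Wweight q s Y a f k l y * Wweight q s X b k c j x
       * Rweight q X Y l j d e x y.
Proof.
move=> hXY hx hy hR; rewrite [RHS]exchange_big /=.
under eq_bigr do under eq_bigr do rewrite fsum_scalel fsum_Wweight //.
under [RHS]eq_bigr do under eq_bigr do rewrite fsum_scaler fsum_Wweight //.
rewrite [vdenom Y y * _]mulrC.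
set P := charge_prefix q s f.
have hP : forall k, P k != 0 by move=> k; exact: charge_prefix_neq0.
case: hXY hR => -[-> ->] /= hR.
- under eq_bigr do under eq_bigr do rewrite R_GammaGammaE //.
  under [RHS]eq_bigr do under eq_bigr do rewrite R_GammaGammaE' //.
  (* All four terms share one conservation condition, and both sides are zero when it fails. *)
  rewrite !sum_swap_eq [evec b + evec a]addrC [evec e + evec d]addrC.
  case: (f + _ == _); last by rewrite !mulr0.
  by apply: eq_two_terms; exact: yb_GammaGamma.
- under eq_bigr do under eq_bigr do rewrite R_DeltaGammaE //.
  under [RHS]eq_bigr do under eq_bigr do rewrite R_DeltaGammaE' //.
  rewrite !sum_pair_diag_eq [evec d + evec b]addrC [evec a + evec e]addrC.
  set C := f + (evec e + evec a) == c + (evec b + evec d).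
  (* On the diagonal, [g] leaves the Delta vertex and enters the Gamma vertex, so it cancels. *)
  have hC : a == b -> forall g,
      (f + (evec e + evec g) == c + (evec g + evec d)) = C.
    by move=> /eqP ab g; rewrite /C ab !eq_cvec_addr.
  have hC' : d == e -> forall l,
      (f + (evec a + evec l) == c + (evec l + evec b)) = C.
    move=> /eqP de l.
    by rewrite /C de [evec e + _]addrC [evec b + _]addrC !eq_cvec_addr.
  have /= -> := sum_diag_scale
    (fun k => if (k < crank a)%N then 1 - q else (1 - q) * q * x * y)
    (fun k => dweight s x P (crank e) k
            * gweight s y (shift q P (crank e) k) k (crank d))
    (q * (x * y - 1)) ((1 - s * x) / s * (s * (1 - s * y)))
    hC.
  have /= -> := sum_diag_scale
    (fun k => if (k < crank d)%N then (1 - q) * q * x * y else 1 - q)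
    (fun k => gweight s y P (crank a) k
            * dweight s x (shift q P (crank a) k) k (crank b))
    (q * (x * y - 1)) ((1 - s * x) / s * (s * (1 - s * y)))
    hC'.
  case: (C); last by rewrite !mulr0.
  apply: eq_two_terms; rewrite !mul1r !eq_crank.
  by apply: yb_DeltaGamma; rewrite ?ltn_crank /P ?charge_prefix0 ?charge_prefix_top.
- under eq_bigr do under eq_bigr do rewrite R_DeltaDeltaE //.
  under [RHS]eq_bigr do under eq_bigr do rewrite R_DeltaDeltaE' //.
  rewrite !sum_swap_eq [evec b + evec a]addrC [evec e + evec d]addrC.
  case: (f + _ == _); last by rewrite !mulr0.
  by apply: eq_two_terms; exact: yb_DeltaDelta.
Qed.

End YangBaxter.

Theorem proposition2p1 (R : realType) (n : nat) (hn : (1 <= n)%N)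
  (q s x y : R[i]) (X Y : vtype)
  (hXY : [\/ (X, Y) = (Gamma, Gamma), (X, Y) = (Delta, Gamma)
           | (X, Y) = (Delta, Delta)])
  (hq : q != 0) (hs : s != 0)
  (hx : 1 - s * x != 0) (hy : 1 - s * y != 0)
  (hR : Rdenom q X Y x y != 0)
  (a b d e : color n) (c f : cvec n) :
  \sum_(g : color n) \sum_(i : color n) \sum_(h \in [set: cvec n])
     Rweight q X Y a b g i x y * Wweight q s X i f h e x
       * Wweight q s Y g h c d y
  = \sum_(j : color n) \sum_(l : color n) \sum_(k \in [set: cvec n])
     Wweight q s Y a f k l y * Wweight q s X b k c j x
       * Rweight q X Y l j d e x y.
Proof. exact: yang_baxter. Qed.
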